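(* Let $0<|q|<1$, let $a,b,c\in\mathbb{C}$ with $|a|<1$, $|b|<1$, $c\notin\{-q^{-j-1}: j\ge0\}$, and fix square roots $a^{1/2},b^{1/2}$ with $a^{1/2}+b^{1/2}\neq0$, and put $(ab)^{1/2}=a^{1/2}b^{1/2}$. Then $$\sum_{n=0}^\infty \frac{(a;q)_n(b;q)_n}{(q;q)_n((ab)^{1/2};q)_n(-(ab)^{1/2};q)_{n+1}}q^{\frac{n(n+1)}{2}}c^n=\frac{(a;q)_\infty(b;q)_\infty(-cq;q)_\infty}{(ab;q^2)_\infty}\sum_{n=0}^\infty\left(\frac{a^{1/2}}{a^{1/2}+b^{1/2}}\cdot\frac{h_n(a,bq\,|\,q^2)}{(q;q)_n(-cq;q)_n}+\frac{b^{1/2}}{a^{1/2}+b^{1/2}}\cdot\frac{h_n(aq,b\,|\,q^2)}{(q;q)_n(-cq;q)_n}\right).$$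
   Context: For $x\in\mathbb{C}$: $(x;q)_\infty=\prod_{j\ge0}(1-xq^j)$ and $(x;q)_n=\prod_{j=0}^{n-1}(1-xq^j)$ for integers $n\ge0$; the same notation is used with base $q^2$. The $q$-binomial coefficient is $\genfrac{[}{]}{0pt}{}{n}{k}_{p}=\frac{(p;p)_n}{(p;p)_k(p;p)_{n-k}}$. The Rogers–Szegő polynomials are $h_n(a,b\,|\,p)=\sum_{k=0}^n\genfrac{[}{]}{0pt}{}{n}{k}_{p}a^kb^{n-k}$. *)

(* Defs.v *)
From Stdlib Require Import Reals.
From Coquelicot Require Import Coquelicot.

Open Scope C_scope.

Fixpoint qpoch (x q : C) (n : nat) : C :=
  match n with
  | O => 1
  | S m => qpoch x q m * (1 - x * q ^ m)
  end.

(* [lim] is total: the value is meaningful only when the partial products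
   converge, which they do for [Cmod q < 1]; see [qpoch_inf_unique]. *)
Definition qpoch_inf (x q : C) : C :=
  lim (T := C_CompleteNormedModule) (filtermap (qpoch x q) eventually).

Lemma qpoch_inf_unique (x q l : C) :
  filterlim (qpoch x q) eventually (locally l) -> qpoch_inf x q = l.
Proof.
intros H.
assert (FF : ProperFilter (filtermap (qpoch x q) eventually))
  by (apply filtermap_proper_filter; apply eventually_filter).
apply (filterlim_locally_unique (K := C_AbsRing) (V := C_NormedModule)
         (F := eventually) (qpoch x q)); [| exact H].
apply filterlim_locally; intros eps.
apply (complete_cauchy (T := C_CompleteNormedModule)
         (filtermap (qpoch x q) eventually) FF).
intros e; exists l.
exact (proj1 (filterlim_locally (qpoch x q) l) H e).
Qed.

(* Only used for [k <= n], since [n - k] is truncated. *)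
Definition qbinom (n k : nat) (p : C) : C :=
  qpoch p p n / (qpoch p p k * qpoch p p (n - k)).

Definition rogers_szego (n : nat) (a b p : C) : C :=
  sum_n (fun k => qbinom n k p * a ^ k * b ^ (n - k)) n.

(* Main.v *)
Require Import Defs.
From Stdlib Require Import Reals Lra Lia.
From Coquelicot Require Import Coquelicot.

Open Scope C_scope.

(** With p = q^2, the three-term recurrence
    h_{n+2}(a,b|p) = (a+b) h_{n+1}(a,b|p) - ab (1 - p^{n+1}) h_n(a,b|p)
    turns G(a,b) = sum_n h_n(a,b|q^2)/(q;q)_n into a solution of
    (1-a)(1-b) G(a,b) = (1-abq) G(aq,bq); iterating and letting the arguments
    tend to 0 gives G(a,b) = (abq;q^2)_oo / ((a;q)_oo (b;q)_oo).  Write x, y for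
    the chosen square roots of a, b.  Since x(1-y^2 t) + y(1-x^2 t) =
    (x+y)(1-xyt), the combination of G(at,bqt) and G(aqt,bt) on the right-hand
    side at t = q^m is, up to the prefactor, the m-th coefficient on the left.
    It remains to exchange the two summations and to sum over m with Euler's
    series sum_m q^{m(m+1)/2} z^m/(q;q)_m = (-zq;q)_oo. *)

(** * Limits and absolutely convergent series in C *)

Lemma C_lim_unique (f : nat -> C) (x y : C) :
  filterlim f eventually (locally x) -> filterlim f eventually (locally y) ->
  x = y.
Proof.
apply (filterlim_locally_unique (K := C_AbsRing) (V := C_NormedModule)).
Qed.

Lemma C_lim_mult (f g : nat -> C) (x y : C) :
  filterlim f eventually (locally x) -> filterlim g eventually (locally y) ->
  filterlim (fun n => f n * g n) eventually (locally (x * y)).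
Proof.
intros Hf Hg.
(* [filterlim_scal] wants the scalar factor to converge in the uniform structure that [C] carries as
   an absolute ring; [locally_C] identifies the two kinds of neighbourhoods. *)
assert (Habs : forall (u : nat -> C) (l : C),
  filterlim u eventually (locally l) ->
  filterlim u eventually (locally (T := AbsRing_UniformSpace C_AbsRing) l)).
{ intros u l Hu P HP; apply Hu, locally_C, HP. }
apply (filterlim_comp_2 f g Cmult (Habs _ _ Hf) Hg).
exact (filterlim_scal (K := C_AbsRing) (V := C_NormedModule) x y).
Qed.

Lemma C_lim_plus (f g : nat -> C) (x y : C) :
  filterlim f eventually (locally x) -> filterlim g eventually (locally y) ->
  filterlim (fun n => f n + g n) eventually (locally (x + y)).
Proof.
intros Hf Hg.
apply (filterlim_comp_2 f g Cplus Hf Hg).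
exact (filterlim_plus (K := C_AbsRing) (V := C_NormedModule) x y).
Qed.

Lemma C_lim_shift (f : nat -> C) (N : nat) (x : C) :
  filterlim f eventually (locally x) <->
  filterlim (fun n => f (n + N)%nat) eventually (locally x).
Proof.
split; intros H P HP; destruct (H P HP) as [M HM].
- exists M; intros n Hn; apply HM; lia.
- exists (M + N)%nat; intros n Hn.
  replace n with ((n - N) + N)%nat by lia.
  apply HM; lia.
Qed.

Lemma C_lim_of_bound (f : nat -> C) (x : C) (e : nat -> R) :
  (forall n, (Cmod (f n - x) <= e n)%R) -> is_lim_seq e 0 ->
  filterlim f eventually (locally x).
Proof.
intros Hb He.
apply (filterlim_ext (fun n => x + (f n - x))); [intros n; ring|].
replace (locally x) with (locally (x + 0)) by (f_equal; ring).
apply C_lim_plus; [apply filterlim_const|].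
apply (filterlim_norm_zero (K := C_AbsRing) (V := C_NormedModule)
  (fun n => f n - x)).
change (is_lim_seq (fun n => Cmod (f n - x)) 0).
apply (is_lim_seq_le_le (fun _ => 0%R) _ e); [|apply is_lim_seq_const|exact He].
intros n; split; [apply Cmod_ge_0|apply Hb].
Qed.

Lemma is_lim_seq_geom_scal (K r : R) :
  (Rabs r < 1)%R -> is_lim_seq (fun n => (K * r ^ n)%R) 0.
Proof.
intros Hr.
replace (Finite 0) with (Rbar_mult K 0) by (simpl; f_equal; ring).
apply is_lim_seq_scal_l, is_lim_seq_geom, Hr.
Qed.

Definition abs_summable (f : nat -> C) : Prop :=
  ex_series (fun n => Cmod (f n)).

Lemma abs_summable_le (f : nat -> C) (b : nat -> R) :
  (forall n, (Cmod (f n) <= b n)%R) -> ex_series b -> abs_summable f.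
Proof.
intros H Hb.
apply (ex_series_le (K := R_AbsRing) (V := R_CompleteNormedModule) _ b);
  [|exact Hb].
intros n; simpl.
change (Rabs (Cmod (f n)) <= b n)%R.
rewrite Rabs_pos_eq by apply Cmod_ge_0; apply H.
Qed.

Lemma abs_summable_mult_bounded (f k : nat -> C) (B : R) :
  (forall n, (Cmod (k n) <= B)%R) -> abs_summable f ->
  abs_summable (fun n => f n * k n).
Proof.
intros Hk Hf.
apply (abs_summable_le _ (fun n => B * Cmod (f n))%R).
- intros n; rewrite Cmod_mult, Rmult_comm.
  apply Rmult_le_compat_r; [apply Cmod_ge_0|apply Hk].
- apply (ex_series_scal (K := R_AbsRing) (V := R_NormedModule) B), Hf.
Qed.

Lemma abs_summable_ex (f : nat -> C) :
  abs_summable f -> exists l : C, is_series f l.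
Proof.
intros H.
apply (ex_series_le (K := C_AbsRing) (V := C_CompleteNormedModule) f
  (fun n => Cmod (f n))); [|exact H].
intros n; apply Rle_refl.
Qed.

Lemma is_series_C_unique (f : nat -> C) (x y : C) :
  is_series f x -> is_series f y -> x = y.
Proof. apply C_lim_unique. Qed.

Lemma is_series_C_plus (f g : nat -> C) (x y : C) :
  is_series f x -> is_series g y -> is_series (fun n => f n + g n) (x + y).
Proof. apply (is_series_plus (K := C_AbsRing) (V := C_NormedModule)). Qed.

Lemma is_series_C_scal (k : C) (f : nat -> C) (x : C) :
  is_series f x -> is_series (fun n => k * f n) (k * x).
Proof. apply (is_series_scal (K := C_AbsRing) (V := C_NormedModule)). Qed.

Lemma is_series_C_ext (f g : nat -> C) (x y : C) :
  (forall n, f n = g n) -> x = y -> is_series f x -> is_series g y.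
Proof. intros H <-; apply is_series_ext, H. Qed.

Lemma is_series_C_tail (f : nat -> C) (x : C) :
  is_series f x -> is_series (fun n => f (S n)) (x - f 0%nat).
Proof.
intros H.
apply (is_series_incr_1 (K := C_AbsRing) (V := C_NormedModule)).
change (is_series f (x - f 0%nat + f 0%nat)).
replace (x - f 0%nat + f 0%nat) with x by ring; exact H.
Qed.

Lemma Cmod_sum_n (f : nat -> C) (n : nat) :
  (Cmod (sum_n f n) <= sum_n (fun k => Cmod (f k)) n)%R.
Proof.
apply (norm_sum_n_m (K := C_AbsRing) (V := C_NormedModule)).
Qed.

Lemma sum_n_le_Series (f : nat -> R) (n : nat) :
  (forall k, (0 <= f k)%R) -> ex_series f -> (sum_n f n <= Series f)%R.
Proof.
intros Hp Hf.
apply (is_lim_seq_incr_compare (sum_n f)).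
- apply (Series_correct f Hf).
- intros k; rewrite sum_Sn; unfold plus; simpl.
  generalize (Hp (S k)); lra.
Qed.

Lemma Cmod_is_series_le (f : nat -> C) (x : C) :
  abs_summable f -> is_series f x ->
  (Cmod x <= Series (fun n => Cmod (f n)))%R.
Proof.
intros Hf Hx.
assert (Hn : is_lim_seq (fun n => Cmod (sum_n f n)) (Cmod x)).
{ apply (filterlim_comp _ _ _ (sum_n f) Cmod _ _ _ Hx).
  apply (filterlim_norm (K := C_AbsRing) (V := C_NormedModule)). }
apply (is_lim_seq_le (fun n => Cmod (sum_n f n))
  (fun _ => Series (fun n => Cmod (f n))) (Cmod x)
  (Series (fun n => Cmod (f n)))); [|exact Hn|apply is_lim_seq_const].
intros n; eapply Rle_trans; [apply Cmod_sum_n|].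
apply (sum_n_le_Series (fun k => Cmod (f k)));
  [intros k; apply Cmod_ge_0|exact Hf].
Qed.

(** Compare the partial sums from [N] to [M] and let [M] tend to infinity. The bound involves only
    [b], so it is uniform over any family of series dominated by [b]. *)
Lemma Cmod_series_remainder (f : nat -> C) (b : nat -> R) (x : C) (N : nat) :
  (forall n, (Cmod (f n) <= b n)%R) -> ex_series b -> is_series f x ->
  (Cmod (sum_n f N - x) <= Series b - sum_n b N)%R.
Proof.
intros Hfb Hb Hx.
assert (Hlim : is_lim_seq (fun M => Cmod (sum_n f N - sum_n f M))
  (Cmod (sum_n f N - x))).
{ apply (filterlim_comp _ _ _ (fun M => sum_n f N - sum_n f M) Cmod _
    (locally (sum_n f N - x)) _).
  2: apply (filterlim_norm (K := C_AbsRing) (V := C_NormedModule)).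
  apply C_lim_plus; [apply filterlim_const|].
  apply (filterlim_comp _ _ _ (sum_n f) Copp _ _ _ Hx).
  apply (filterlim_opp (K := C_AbsRing) (V := C_NormedModule)). }
apply (is_lim_seq_le_loc (fun M => Cmod (sum_n f N - sum_n f M))
   (fun M => sum_n b M - sum_n b N)%R
   (Finite (Cmod (sum_n f N - x))) (Finite (Series b - sum_n b N)%R));
  [|exact Hlim|].
2:{ apply is_lim_seq_minus'; [|apply is_lim_seq_const].
    apply (Series_correct _ Hb). }
exists N; intros M HM.
induction HM as [|M HM IH].
- unfold Cminus; rewrite Cplus_opp_r, Cmod_0; lra.
- rewrite !sum_Sn; unfold plus; simpl.
  replace (sum_n f N - (sum_n f M + f (S M)))
    with ((sum_n f N - sum_n f M) + - f (S M)) by ring.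
  eapply Rle_trans; [apply Cmod_triangle|].
  rewrite Cmod_opp.
  generalize (Hfb (S M)).
  simpl in IH; lra.
Qed.

(** Fubini for the double series with terms [u m * g n * k m n]. A finite sum over [m] commutes with
    the series in [n]; what is left is bounded by the tail of [u] in modulus times the full sum of
    [g] in modulus, and this tends to 0. *)
Lemma is_series_C_exchange (u g Phi Psi : nat -> C) (k : nat -> nat -> C) :
  abs_summable u -> abs_summable g ->
  (forall m n, (Cmod (k m n) <= 1)%R) ->
  (forall m, is_series (fun n => g n * k m n) (Phi m)) ->
  (forall n, is_series (fun m => u m * k m n) (Psi n)) ->
  exists s, is_series (fun m => u m * Phi m) s /\
            is_series (fun n => g n * Psi n) s.
Proof.
intros Hu Hg Hk HPhi HPsi.
set (U := Series (fun n => Cmod (u n))).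
(* Boundedness of [Psi] makes the series of [g n * Psi n] absolutely convergent, which supplies the
   common value [s]. *)
assert (HPsiB : forall n, (Cmod (Psi n) <= U)%R).
{ intros n.
  eapply Rle_trans; [apply (Cmod_is_series_le _ _
    (abs_summable_mult_bounded _ _ 1 (fun m => Hk m n) Hu) (HPsi n))|].
  apply Series_le; [|exact Hu].
  intros m; split; [apply Cmod_ge_0|].
  rewrite Cmod_mult; generalize (Hk m n) (Cmod_ge_0 (u m)); nra. }
assert (HgP := abs_summable_mult_bounded _ _ U HPsiB Hg).
destruct (abs_summable_ex _ HgP) as [s Hs].
exists s; split; [|exact Hs].
assert (Hpart : forall N, is_series
  (fun n => g n * sum_n (fun m => u m * k m n) N)
  (sum_n (fun m => u m * Phi m) N)).
{ induction N as [|N IH].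
  - rewrite sum_O.
    eapply is_series_C_ext;
      [|reflexivity|apply (is_series_C_scal (u O) _ _ (HPhi O))].
    intros n; rewrite sum_O; ring.
  - rewrite sum_Sn.
    eapply is_series_C_ext; [|reflexivity|
      apply (is_series_C_plus _ _ _ _ IH
        (is_series_C_scal (u (S N)) _ _ (HPhi (S N))))].
    intros n; rewrite sum_Sn; unfold plus; simpl; ring. }
set (G := Series (fun n => Cmod (g n))).
apply (C_lim_of_bound _ _
  (fun N => G * (U - sum_n (fun m => Cmod (u m)) N))%R).
2:{ replace (Finite 0) with (Rbar_mult G (Finite (U - U)%R))
      by (simpl; f_equal; ring).
    apply is_lim_seq_scal_l.
    apply is_lim_seq_minus'; [apply is_lim_seq_const|].
    apply (Series_correct _ Hu). }
intros N.
(* The remainder in [m] is bounded uniformly in [n], because the kernel has modulus at most 1. *)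
assert (Htail : forall n, (Cmod (sum_n (fun m => u m * k m n)%C N - Psi n)
  <= U - sum_n (fun m => Cmod (u m)) N)%R).
{ intros n.
  apply (Cmod_series_remainder (fun m => u m * k m n));
    [|exact Hu|apply HPsi].
  intros m; rewrite Cmod_mult.
  generalize (Hk m n) (Cmod_ge_0 (u m)); nra. }
set (T := (U - sum_n (fun m => Cmod (u m)) N)%R) in *.
assert (Hd := is_series_C_plus _ _ _ _ (Hpart N)
  (is_series_C_scal (-(1)) _ _ Hs)).
assert (Hd' : is_series
  (fun n => g n * (sum_n (fun m => u m * k m n) N - Psi n))
  (sum_n (fun m => u m * Phi m) N - s)).
{ eapply is_series_C_ext; [| |exact Hd].
  - intros n; simpl; ring.
  - ring. }
eapply Rle_trans; [apply (Cmod_is_series_le _ _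
  (abs_summable_mult_bounded _ _ T Htail Hg) Hd')|].
unfold G; rewrite Rmult_comm, <- Series_scal_l.
apply Series_le.
- intros n; split; [apply Cmod_ge_0|].
  rewrite Cmod_mult, Rmult_comm.
  apply Rmult_le_compat_r; [apply Cmod_ge_0|apply Htail].
- apply (ex_series_scal (K := R_AbsRing) (V := R_NormedModule) T), Hg.
Qed.

Lemma C_lim_correct (f : nat -> C) :
  (exists l : C, filterlim f eventually (locally l)) ->
  filterlim f eventually
    (locally (lim (T := C_CompleteNormedModule) (filtermap f eventually))).
Proof.
intros [l Hl].
assert (FF : ProperFilter (filtermap f eventually))
  by (apply filtermap_proper_filter; apply eventually_filter).
apply filterlim_locally; intros eps.
apply (complete_cauchy (T := C_CompleteNormedModule) (filtermap f eventually) FF).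
intros e; exists l.
exact (proj1 (filterlim_locally f l) Hl e).
Qed.

(** A total function, since [lim] is; the value is meaningful only for a convergent series. *)
Definition C_Series (f : nat -> C) : C :=
  lim (T := C_CompleteNormedModule) (filtermap (sum_n f) eventually).

Lemma C_Series_correct (f : nat -> C) :
  abs_summable f -> is_series f (C_Series f).
Proof. intros H; apply C_lim_correct, abs_summable_ex, H. Qed.

Lemma abs_summable_tail (f : nat -> C) :
  abs_summable f -> abs_summable (fun n => f (S n)).
Proof.
apply (ex_series_incr_1 (K := R_AbsRing) (V := R_NormedModule)
  (fun n => Cmod (f n))).
Qed.

(** * Infinite products *)

(** The products stay below [Cmod (P O)] times the exponential of the sum of the [Cmod (u n)], so
    the increments [P (S n) - P n = u n * P n] are absolutely summable. The recursive form covers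
    both [qpoch] and its reciprocal. *)
Lemma infinite_product_cv (P u : nat -> C) :
  (forall n, P (S n) = P n * (1 + u n)) -> abs_summable u ->
  exists l : C, filterlim P eventually (locally l).
Proof.
intros HP Hu.
assert (HB : forall n, (Cmod (P (S n))
   <= Cmod (P O) * exp (sum_n (fun k => Cmod (u k)) n))%R).
{ assert (Hstep : forall n, (Cmod (P (S n)) <= Cmod (P n) * exp (Cmod (u n)))%R).
  { intros n; rewrite HP, Cmod_mult.
    apply Rmult_le_compat_l; [apply Cmod_ge_0|].
    eapply Rle_trans; [apply Cmod_triangle|].
    rewrite Cmod_1; apply exp_ineq1_le. }
  induction n as [|n IH].
  - rewrite sum_O; apply Hstep.
  - rewrite sum_Sn; unfold plus; simpl; rewrite exp_plus, <- Rmult_assoc.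
    eapply Rle_trans; [apply Hstep|].
    apply Rmult_le_compat_r; [left; apply exp_pos|exact IH]. }
assert (HPu : abs_summable (fun n => u (S n) * P (S n))).
{ apply (abs_summable_mult_bounded (fun n => u (S n)) (fun n => P (S n))
    (Cmod (P O) * exp (Series (fun k => Cmod (u k))))).
  - intros n; eapply Rle_trans; [apply HB|].
    apply Rmult_le_compat_l; [apply Cmod_ge_0|].
    assert (Hs := sum_n_le_Series _ n (fun k => Cmod_ge_0 (u k)) Hu).
    destruct Hs as [Hs|Hs]; [left; apply exp_increasing, Hs|rewrite Hs; lra].
  - apply (abs_summable_tail u), Hu. }
destruct (abs_summable_ex _ HPu) as [l Hl].
exists (P 1%nat + l).
(* The bound [HB] starts at [P 1], so the telescoping does too: the increments summed up to index
   [n] lead from [P 1] to [P (n + 2)]. *)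
apply (C_lim_shift P 2).
apply (filterlim_ext (fun n => P 1%nat + sum_n (fun n => u (S n) * P (S n)) n)).
- induction x as [|n IH].
  + rewrite sum_O; change (0 + 2)%nat with 2%nat; rewrite (HP 1%nat); ring.
  + rewrite sum_Sn; change (S n + 2)%nat with (S (n + 2)).
    rewrite (HP (n + 2)%nat), <- IH.
    replace (S (S n)) with (n + 2)%nat by lia.
    rewrite <- IH; unfold plus; simpl; ring.
- apply C_lim_plus; [apply filterlim_const|exact Hl].
Qed.

Lemma abs_summable_geom (x q : C) :
  (Cmod q < 1)%R -> abs_summable (fun n => x * q ^ n).
Proof.
intros Hq.
apply (abs_summable_le _ (fun n => (Cmod x * Cmod q ^ n)%R)).
- intros n; rewrite Cmod_mult, Cmod_pow; lra.
- apply (ex_series_scal (K := R_AbsRing) (V := R_NormedModule) (Cmod x)).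
  apply ex_series_geom; rewrite Rabs_pos_eq by apply Cmod_ge_0; exact Hq.
Qed.

Lemma qpoch_cv (x q : C) :
  (Cmod q < 1)%R ->
  filterlim (qpoch x q) eventually (locally (qpoch_inf x q)).
Proof.
intros Hq.
apply C_lim_correct, (infinite_product_cv _ (fun n => - x * q ^ n)).
- intros n; simpl; ring.
- apply abs_summable_geom, Hq.
Qed.

Lemma qpoch_succ (x q : C) (n : nat) :
  qpoch x q (S n) = qpoch x q n * (1 - x * q ^ n).
Proof. reflexivity. Qed.

Lemma qpoch_add (x q : C) (m n : nat) :
  qpoch x q (m + n) = qpoch x q m * qpoch (x * q ^ m) q n.
Proof.
induction n as [|n IH].
- rewrite Nat.add_0_r; simpl; ring.
- rewrite Nat.add_succ_r; simpl; rewrite IH, Cpow_add_r; ring.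
Qed.

Lemma qpoch_inf_split (x q : C) (m : nat) :
  (Cmod q < 1)%R ->
  qpoch_inf x q = qpoch x q m * qpoch_inf (x * q ^ m) q.
Proof.
intros Hq; apply qpoch_inf_unique, (C_lim_shift _ m).
apply (filterlim_ext (fun n => qpoch x q m * qpoch (x * q ^ m) q n)).
- intros n; rewrite <- qpoch_add; f_equal; lia.
- apply C_lim_mult; [apply filterlim_const|apply qpoch_cv, Hq].
Qed.

(** * Reciprocals and non-vanishing of the products *)

Lemma one_minus_neq0 (z : C) : z <> 1 -> 1 - z <> 0.
Proof.
intros Hz H; apply Hz.
replace z with (1 - (1 - z)) by ring; rewrite H; ring.
Qed.

Lemma qpoch_neq0 (x q : C) (n : nat) :
  (forall j, x * q ^ j <> 1) -> qpoch x q n <> 0.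
Proof.
intros H; induction n as [|n IH]; simpl; [apply C1_nz|].
apply Cmult_neq_0; [exact IH|apply one_minus_neq0, H].
Qed.

Lemma Cmod_pow_le_1 (q : C) (n : nat) :
  (Cmod q <= 1)%R -> (Cmod (q ^ n) <= 1)%R.
Proof.
intros Hq; rewrite Cmod_pow, <- (pow1 n).
apply pow_incr; split; [apply Cmod_ge_0|exact Hq].
Qed.

Lemma Cmod_mult_pow_lt (x q : C) (j : nat) :
  (Cmod x < 1)%R -> (Cmod q <= 1)%R -> (Cmod (x * q ^ j) < 1)%R.
Proof.
intros Hx Hq; rewrite Cmod_mult.
generalize (Cmod_pow_le_1 q j Hq) (Cmod_ge_0 x) (Cmod_ge_0 (q ^ j)); nra.
Qed.

Lemma neq1_of_Cmod_lt (z : C) : (Cmod z < 1)%R -> z <> 1.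
Proof. intros H ->; rewrite Cmod_1 in H; lra. Qed.

(** Since 1/(1-z) = 1 + z/(1-z), the reciprocals again form a product with summable deviations, as
    |1 - x q^n| >= 1 - |x|. This yields both the non-vanishing of the limit and bounds on
    1/(q;q)_n. *)
Lemma qpoch_inv_cv (x q : C) :
  (Cmod x < 1)%R -> (Cmod q < 1)%R ->
  exists l : C, filterlim (fun n => / qpoch x q n) eventually (locally l).
Proof.
intros Hx Hq.
assert (Hlt : forall j, (Cmod (x * q ^ j) <= Cmod x)%R).
{ intros j; rewrite Cmod_mult.
  generalize (Cmod_pow_le_1 q j (Rlt_le _ _ Hq)) (Cmod_ge_0 x); nra. }
assert (Hn : forall j, 1 - x * q ^ j <> 0).
{ intros j; apply one_minus_neq0, neq1_of_Cmod_lt.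
  eapply Rle_lt_trans; [apply Hlt|exact Hx]. }
apply (infinite_product_cv _ (fun n => x * q ^ n * / (1 - x * q ^ n))).
- intros n; simpl.
  assert (qpoch x q n <> 0).
  { apply qpoch_neq0; intros j Hj; apply (Hn j); rewrite Hj; ring. }
  field; auto.
- apply (abs_summable_mult_bounded (fun n => x * q ^ n)
    (fun n => / (1 - x * q ^ n)) (/ (1 - Cmod x))).
  2: apply abs_summable_geom, Hq.
  intros n; rewrite Cmod_inv by apply Hn.
  apply Rinv_le_contravar; [lra|].
  assert (Ht := Cmod_triangle (1 - x * q ^ n) (x * q ^ n)).
  replace (1 - x * q ^ n + x * q ^ n) with (RtoC 1) in Ht by ring.
  rewrite Cmod_1 in Ht; generalize (Hlt n); lra.
Qed.

Lemma C_seq_bounded (f : nat -> C) :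
  (exists l : C, filterlim f eventually (locally l)) ->
  exists B : R, forall n, (Cmod (f n) <= B)%R.
Proof.
intros H.
destruct (filterlim_bounded (K := C_AbsRing) (V := C_NormedModule) f H)
  as [B HB].
exists B; exact HB.
Qed.

(** The partial products and their reciprocals both converge and multiply to 1, so a zero limit
    would give 0 = 1. *)
Lemma qpoch_inf_neq0_small (x q : C) :
  (Cmod x < 1)%R -> (Cmod q < 1)%R -> qpoch_inf x q <> 0.
Proof.
intros Hx Hq H0.
destruct (qpoch_inv_cv x q Hx Hq) as [l Hl].
assert (H1 := C_lim_mult _ _ _ _ (qpoch_cv x q Hq) Hl).
rewrite H0, Cmult_0_l in H1.
apply C1_nz, (C_lim_unique (fun _ => RtoC 1)); [apply filterlim_const|].
apply (filterlim_ext (fun n => qpoch x q n * / qpoch x q n)); [|exact H1].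
intros n; apply Cinv_r, qpoch_neq0.
intros j; apply neq1_of_Cmod_lt, Cmod_mult_pow_lt; lra.
Qed.

Lemma qpoch_inf_neq0 (x q : C) :
  (Cmod q < 1)%R -> (forall j, x * q ^ j <> 1) -> qpoch_inf x q <> 0.
Proof.
intros Hq Hx.
assert (Hlim : is_lim_seq (fun n => (Cmod x * Cmod q ^ n)%R) 0).
{ apply is_lim_seq_geom_scal; rewrite Rabs_pos_eq by apply Cmod_ge_0; exact Hq. }
apply is_lim_seq_spec in Hlim.
(* After [N] factors the argument [x * q ^ N] lies in the unit disc, where the previous lemma
   applies. *)
destruct (Hlim (mkposreal 1 Rlt_0_1)) as [N HN].
specialize (HN N (le_n N)); simpl in HN.
rewrite Rminus_0_r, <- Cmod_pow, <- Cmod_mult in HN.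
rewrite Rabs_pos_eq in HN by apply Cmod_ge_0.
rewrite (qpoch_inf_split x q N Hq).
apply Cmult_neq_0; [apply qpoch_neq0, Hx|].
apply qpoch_inf_neq0_small; assumption.
Qed.

(** Continuity at 0 of a power series along the points [q ^ M]: all terms but the constant one carry
    a factor of modulus at most |q|^M. It closes both iterations of a functional equation below. *)
Lemma series_at_geometric_cv (f F : nat -> C) (q : C) :
  (Cmod q < 1)%R -> abs_summable f ->
  (forall M, is_series (fun n => f n * (q ^ M) ^ n) (F M)) ->
  filterlim F eventually (locally (f 0%nat)).
Proof.
intros Hq Hf HF.
assert (Hf1 : abs_summable (fun n => f (S n)))
  by (apply (abs_summable_tail f), Hf).
apply (C_lim_of_bound _ _
  (fun M => Series (fun n => Cmod (f (S n))) * Cmod q ^ M)%R).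
2:{ apply is_lim_seq_geom_scal; rewrite Rabs_pos_eq by apply Cmod_ge_0; exact Hq. }
intros M.
assert (HM := is_series_C_tail _ _ (HF M)).
cbv beta in HM; change ((q ^ M) ^ 0) with (RtoC 1) in HM.
rewrite Cmult_1_r in HM.
assert (Hb : forall n, (Cmod ((q ^ M) ^ S n) <= Cmod q ^ M)%R).
{ intros n; rewrite Cpow_S, Cmod_mult, Cmod_pow.
  assert (H1 := Cmod_pow_le_1 _ n (Cmod_pow_le_1 q M (Rlt_le _ _ Hq))).
  generalize (pow_le (Cmod q) M (Cmod_ge_0 q)); nra. }
eapply Rle_trans; [apply (Cmod_is_series_le _ _
  (abs_summable_mult_bounded _ _ _ Hb Hf1) HM)|].
rewrite Rmult_comm, <- Series_scal_l.
apply Series_le.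
- intros n; split; [apply Cmod_ge_0|].
  rewrite Cmod_mult, Rmult_comm.
  apply Rmult_le_compat_r; [apply Cmod_ge_0|apply Hb].
- apply (ex_series_scal (K := R_AbsRing) (V := R_NormedModule)), Hf1.
Qed.

(** * Euler's series *)

Lemma triangle_succ (n : nat) :
  (S n * (S n + 1) / 2 = n * (n + 1) / 2 + S n)%nat.
Proof.
replace (S n * (S n + 1))%nat with (n * (n + 1) + S n * 2)%nat by ring.
apply Nat.div_add; lia.
Qed.

Lemma euler_abs_summable (z q : C) :
  (0 < Cmod q)%R -> (Cmod q < 1)%R ->
  abs_summable (fun n => q ^ (n * (n + 1) / 2) * z ^ n / qpoch q q n).
Proof.
intros Hq0 Hq.
destruct (C_seq_bounded _ (qpoch_inv_cv q q Hq Hq)) as [B HB].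
apply (abs_summable_mult_bounded (fun n => q ^ (n * (n + 1) / 2) * z ^ n)
  (fun n => / qpoch q q n) B HB).
(* The ratio test needs nonzero terms; replacing |z| by |z| + 1 also covers [z = 0]. *)
set (Z := (Cmod z + 1)%R).
assert (HZ : (0 < Z)%R) by (unfold Z; generalize (Cmod_ge_0 z); lra).
set (e := fun n => (Cmod q ^ (n * (n + 1) / 2) * Z ^ n)%R).
assert (He : forall n, (0 < e n)%R)
  by (intros n; apply Rmult_lt_0_compat; apply pow_lt; assumption).
apply (abs_summable_le _ (fun n => Rabs (e n))).
- intros n; rewrite Cmod_mult, !Cmod_pow, Rabs_pos_eq by apply Rlt_le, He.
  apply Rmult_le_compat_l; [apply pow_le; lra|].
  apply pow_incr; split; [apply Cmod_ge_0|unfold Z; lra].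
- apply (ex_series_DAlembert e 0); [lra|intros n; apply Rgt_not_eq, He|].
  apply (is_lim_seq_ext (fun n => (Z * Cmod q) * Cmod q ^ n)%R).
  + intros n.
    assert (Hr : (e (S n) / e n = Z * Cmod q * Cmod q ^ n)%R).
    { unfold e; rewrite triangle_succ, pow_add; simpl; field.
      split; apply Rgt_not_eq, pow_lt; assumption. }
    rewrite Hr, Rabs_pos_eq; [reflexivity|].
    generalize (pow_lt _ n Hq0); intros; apply Rlt_le.
    repeat apply Rmult_lt_0_compat; assumption.
  + apply is_lim_seq_geom_scal; rewrite Rabs_pos_eq; lra.
Qed.

(** With E(z) the sum of the series, E(z) = (1 + zq) E(zq). In the proof [E M] is E(z q^M);
    iterating and letting [M] grow leaves the product times E(0) = 1. *)
Lemma euler_series (z q : C) :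
  (0 < Cmod q)%R -> (Cmod q < 1)%R ->
  is_series (fun n => q ^ (n * (n + 1) / 2) * z ^ n / qpoch q q n)
    (qpoch_inf (- z * q) q).
Proof.
intros Hq0 Hq.
set (e := fun n => q ^ (n * (n + 1) / 2) * z ^ n / qpoch q q n).
assert (He : abs_summable e) by (apply euler_abs_summable; assumption).
set (E := fun M => C_Series (fun n => e n * (q ^ M) ^ n)).
assert (HE : forall M, is_series (fun n => e n * (q ^ M) ^ n) (E M)).
{ intros M; apply C_Series_correct.
  apply (abs_summable_mult_bounded _ _ 1); [|exact He].
  intros n; apply Cmod_pow_le_1, Cmod_pow_le_1; lra. }
assert (Hnz : forall n, qpoch q q n <> 0).
{ intros n; apply qpoch_neq0; intros j.
  apply neq1_of_Cmod_lt, Cmod_mult_pow_lt; lra. }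
(* This is the functional equation read off on coefficients. *)
assert (Hstep : forall n, e (S n) * (1 - q ^ S n) = z * q ^ S n * e n).
{ intros n; unfold e; rewrite triangle_succ, Cpow_add_r, (Cpow_S z).
  change (qpoch q q (S n)) with (qpoch q q n * (1 - q * q ^ n)).
  assert (H1 := Hnz (S n)).
  change (qpoch q q (S n)) with (qpoch q q n * (1 - q * q ^ n)) in H1.
  rewrite <- (Cpow_S q n) in *.
  assert (H2 : 1 - q ^ S n <> 0) by (intros H2; apply H1; rewrite H2; ring).
  field; split; [apply Hnz|exact H2]. }
assert (Hfun : forall M, E M = (1 + z * q * q ^ M) * E (S M)).
{ intros M.
  assert (H1 := is_series_C_tail _ _ (HE M)).
  assert (H2 := is_series_C_tail _ _ (HE (S M))).
  assert (H3 := is_series_C_plus _ _ _ _ H2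
    (is_series_C_scal (z * q * q ^ M) _ _ (HE (S M)))).
  cbv beta in H1, H3.
  assert (H4 : E M - e 0%nat * (q ^ M) ^ 0
    = E (S M) - e 0%nat * (q ^ S M) ^ 0 + z * q * q ^ M * E (S M)).
  { apply (is_series_C_unique (fun n => e (S n) * (q ^ M) ^ S n));
      [exact H1|].
    eapply is_series_C_ext; [|reflexivity|exact H3].
    intros n; cbv beta.
    rewrite (Cpow_S q M), !Cpow_mult_l, (Cpow_S (q ^ M) n).
    replace (z * q * q ^ M * (e n * (q ^ n * (q ^ M) ^ n)))
      with (z * q ^ S n * e n * (q ^ M * (q ^ M) ^ n))
      by (rewrite Cpow_S; ring).
    rewrite <- Hstep; ring. }
  change ((q ^ M) ^ 0) with (RtoC 1) in H4.
  change ((q ^ S M) ^ 0) with (RtoC 1) in H4.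
  replace (E M) with (E M - e 0%nat * 1 + e 0%nat * 1) by ring.
  rewrite H4; ring. }
assert (Hiter : forall M, E 0%nat = qpoch (- z * q) q M * E M).
{ induction M as [|M IH]; [simpl; ring|].
  rewrite IH, (Hfun M); simpl; ring. }
assert (Hlim := C_lim_mult _ _ _ _ (qpoch_cv (- z * q) q Hq)
  (series_at_geometric_cv e E q Hq He HE)).
assert (HE0 : E 0%nat = qpoch_inf (- z * q) q * e 0%nat).
{ eapply C_lim_unique; [|exact Hlim].
  apply (filterlim_ext (fun _ => E 0%nat)); [exact Hiter|].
  apply filterlim_const. }
replace (e 0%nat) with (RtoC 1) in HE0
  by (unfold e; change (0 * (0 + 1) / 2)%nat with 0%nat; simpl; field).
rewrite Cmult_1_r in HE0; rewrite <- HE0.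
eapply is_series_C_ext; [|reflexivity|apply (HE 0%nat)].
intros n; simpl; rewrite Cpow_1_l; ring.
Qed.

(** * Rogers-Szego polynomials *)

Lemma sum_n_head (f : nat -> C) (n : nat) :
  sum_n f (S n) = f 0%nat + sum_n (fun k => f (S k)) n.
Proof.
induction n as [|n IH].
- rewrite sum_Sn, !sum_O; reflexivity.
- rewrite sum_Sn, IH, (sum_Sn (fun k => f (S k))).
  unfold plus; simpl; ring.
Qed.

Lemma sum_n_C_plus (f g : nat -> C) (n : nat) :
  sum_n (fun k => f k + g k) n = sum_n f n + sum_n g n.
Proof. apply (sum_n_plus (G := C_AbelianMonoid)). Qed.

Lemma sum_n_C_scal (x : C) (f : nat -> C) (n : nat) :
  sum_n (fun k => x * f k) n = x * sum_n f n.
Proof. apply (sum_n_mult_l (K := C_Ring)). Qed.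

Lemma sum_n_C_ext (f g : nat -> C) (n : nat) :
  (forall k, (k <= n)%nat -> f k = g k) -> sum_n f n = sum_n g n.
Proof. apply (sum_n_ext_loc (G := C_AbelianMonoid)). Qed.

Lemma qpoch_self_neq0 (q : C) (n : nat) :
  (Cmod q < 1)%R -> qpoch q q n <> 0.
Proof.
intros Hq; apply qpoch_neq0; intros j.
apply neq1_of_Cmod_lt, Cmod_mult_pow_lt; lra.
Qed.

Lemma qpoch_self_ratio (p x : C) (n : nat) :
  (Cmod p < 1)%R ->
  (1 - p ^ S n) * (x ^ S n / qpoch p p (S n)) = x * (x ^ n / qpoch p p n).
Proof.
intros Hp.
assert (H1 := qpoch_self_neq0 p n Hp).
assert (H2 := qpoch_self_neq0 p (S n) Hp).
change (qpoch p p (S n)) with (qpoch p p n * (1 - p * p ^ n)) in *.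
rewrite !Cpow_S in *.
assert (H3 : 1 - p * p ^ n <> 0) by (intros H3; apply H2; rewrite H3; ring).
field; split; assumption.
Qed.

(** The summand of h_n/(p;p)_n, which is the Cauchy product of the sequences a^k/(p;p)_k and
    b^j/(p;p)_j. *)
Definition rs_term (a b p : C) (n k : nat) : C :=
  a ^ k / qpoch p p k * (b ^ (n - k) / qpoch p p (n - k)).

Lemma rogers_szego_rs_term (n : nat) (a b p : C) :
  (Cmod p < 1)%R ->
  rogers_szego n a b p = qpoch p p n * sum_n (rs_term a b p n) n.
Proof.
intros Hp; unfold rogers_szego; rewrite <- sum_n_C_scal.
apply sum_n_C_ext; intros k _; unfold qbinom, rs_term.
assert (H1 := qpoch_self_neq0 p k Hp).
assert (H2 := qpoch_self_neq0 p (n - k) Hp).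
field; split; assumption.
Qed.

(** The weight kills the term [k = 0], and in the others it cancels the last factor of (p;p)_k,
    which lowers [k] by one and releases an [a]. *)
Lemma rs_term_sum_weighted (a b p : C) (n : nat) :
  (Cmod p < 1)%R ->
  sum_n (fun k => (1 - p ^ k) * rs_term a b p (S n) k) (S n)
  = a * sum_n (rs_term a b p n) n.
Proof.
intros Hp; rewrite sum_n_head, <- sum_n_C_scal.
replace ((1 - p ^ 0) * rs_term a b p (S n) 0) with (RtoC 0) by (simpl; ring).
rewrite Cplus_0_l; apply sum_n_C_ext; intros k _.
unfold rs_term; rewrite Cmult_assoc, qpoch_self_ratio by exact Hp.
rewrite Cmult_assoc; reflexivity.
Qed.

(* Split [1 - p^(n+1) = (1 - p^k) + p^k (1 - p^(n+1-k))] in the convolution. *)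
Lemma rs_term_sum_succ (a b p : C) (n : nat) :
  (Cmod p < 1)%R ->
  (1 - p ^ S n) * sum_n (rs_term a b p (S n)) (S n)
  = a * sum_n (rs_term a b p n) n
    + b * sum_n (fun k => p ^ k * rs_term a b p n k) n.
Proof.
intros Hp.
rewrite <- (rs_term_sum_weighted a b p n Hp), <- !sum_n_C_scal.
rewrite (sum_n_C_ext (fun k => (1 - p ^ S n) * rs_term a b p (S n) k)
  (fun k => (1 - p ^ k) * rs_term a b p (S n) k
     + p ^ k * (1 - p ^ (S n - k)) * rs_term a b p (S n) k)).
2:{ intros k Hk.
    replace (p ^ S n) with (p ^ k * p ^ (S n - k))
      by (rewrite <- Cpow_add_r; f_equal; lia).
    ring. }
rewrite sum_n_C_plus; f_equal.
(* The term [k = S n] is split off: its factor 1 - p^0 vanishes. For the remaining [k <= n] the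
   subtraction [S n - k] is positive and lowers by one. *)
rewrite sum_Sn; unfold plus; simpl.
replace (n - n)%nat with 0%nat by lia.
replace (p ^ 0) with (RtoC 1) by reflexivity.
replace (p * p ^ n * (1 - 1) * rs_term a b p (S n) (S n)) with (RtoC 0) by ring.
rewrite Cplus_0_r; apply sum_n_C_ext; intros k Hk.
unfold rs_term; destruct k as [|k].
- rewrite !Nat.sub_0_r.
  transitivity (p ^ 0 * (a ^ 0 / qpoch p p 0)
    * ((1 - p ^ S n) * (b ^ S n / qpoch p p (S n)))); [simpl; ring|].
  rewrite qpoch_self_ratio by exact Hp; ring.
- replace (S n - S k)%nat with (S (n - S k)) by lia.
  replace (n - k)%nat with (S (n - S k)) by lia.
  transitivity (p ^ S k * (a ^ S k / qpoch p p (S k))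
    * ((1 - p ^ S (n - S k)) * (b ^ S (n - S k) / qpoch p p (S (n - S k)))));
    [ring|].
  rewrite qpoch_self_ratio by exact Hp; ring.
Qed.

Lemma rogers_szego_rec (a b p : C) (n : nat) :
  (Cmod p < 1)%R ->
  rogers_szego (S (S n)) a b p
  = (a + b) * rogers_szego (S n) a b p
    - a * b * (1 - p ^ S n) * rogers_szego n a b p.
Proof.
intros Hp; rewrite !rogers_szego_rs_term by exact Hp.
assert (H1 := rs_term_sum_succ a b p (S n) Hp).
assert (H2 := rs_term_sum_weighted a b p n Hp).
rewrite (sum_n_C_ext _ (fun k => rs_term a b p (S n) k
  + -(1) * (p ^ k * rs_term a b p (S n) k))) in H2 by (intros; ring).
rewrite sum_n_C_plus, sum_n_C_scal in H2.
(* [D] is the only unwanted sum: [H2] expresses it as [R1 - a * R0], and substituting this in [H1]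
   gives the recurrence for h_n/(p;p)_n. *)
set (D := sum_n (fun k => p ^ k * rs_term a b p (S n) k) (S n)) in *.
set (R0 := sum_n (rs_term a b p n) n) in *.
set (R1 := sum_n (rs_term a b p (S n)) (S n)) in *.
clearbody D R0 R1.
change (AbelianMonoid.sort C_AbelianMonoid) with C in D, R0, R1.
assert (HD : D = R1 - a * R0) by (rewrite <- H2; ring).
change (qpoch p p (S (S n))) with (qpoch p p (S n) * (1 - p * p ^ S n)).
rewrite <- Cpow_S, <- Cmult_assoc, H1, HD.
change (qpoch p p (S n)) with (qpoch p p n * (1 - p * p ^ n)).
rewrite (Cpow_S p n); ring.
Qed.

Lemma rogers_szego_0 (a b p : C) : rogers_szego 0 a b p = 1.
Proof.
unfold rogers_szego, qbinom; rewrite sum_O; simpl; field.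
Qed.

Lemma rogers_szego_1 (a b p : C) :
  (Cmod p < 1)%R -> rogers_szego 1 a b p = a + b.
Proof.
intros Hp; unfold rogers_szego, qbinom; rewrite sum_Sn, sum_O.
assert (H := qpoch_self_neq0 p 1 Hp).
unfold plus; simpl in *; field.
intros H0; apply H; rewrite <- H0; ring.
Qed.

Lemma rogers_szego_scale (n : nat) (a b t p : C) :
  rogers_szego n (a * t) (b * t) p = rogers_szego n a b p * t ^ n.
Proof.
unfold rogers_szego; rewrite (Cmult_comm _ (t ^ n)), <- sum_n_C_scal.
apply sum_n_C_ext; intros k Hk.
rewrite !Cpow_mult_l.
replace (t ^ n) with (t ^ k * t ^ (n - k))
  by (rewrite <- Cpow_add_r; f_equal; lia).
ring.
Qed.

(** * The generating function of the Rogers-Szegő polynomials *)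

Lemma rogers_szego_abs_summable (a b q : C) :
  (Cmod q < 1)%R -> (Cmod a < 1)%R -> (Cmod b < 1)%R ->
  abs_summable (fun n => rogers_szego n a b (q ^ 2) / qpoch q q n).
Proof.
intros Hq Ha Hb.
assert (Hp : (Cmod (q ^ 2) < 1)%R)
  by (rewrite Cmod_pow; generalize (Cmod_ge_0 q); simpl; nra).
destruct (C_seq_bounded _ (qpoch_inv_cv q q Hq Hq)) as [B HB].
destruct (C_seq_bounded _ (qpoch_inv_cv (q ^ 2) (q ^ 2) Hp Hp)) as [B2 HB2].
destruct (C_seq_bounded _ (ex_intro (fun l : C => filterlim _ _ (locally l))
  _ (qpoch_cv (q ^ 2) (q ^ 2) Hp)))
  as [M HM].
apply abs_summable_mult_bounded with (1 := HB).
(* [M] bounds (q^2;q^2)_n and [B2] its reciprocal, so the polynomial is dominated by the Cauchy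
   product of two geometric sequences. *)
apply (abs_summable_le _ (fun n => M * (B2 * B2) * sum_f_R0
  (fun k => Cmod a ^ k * Cmod b ^ (n - k)) n)%R).
- intros n; rewrite rogers_szego_rs_term by exact Hp.
  rewrite Cmod_mult, Rmult_assoc.
  apply Rmult_le_compat; try apply Cmod_ge_0; [apply HM|].
  eapply Rle_trans; [apply Cmod_sum_n|].
  rewrite sum_n_Reals, scal_sum.
  apply sum_Rle; intros k _.
  unfold rs_term, Cdiv; rewrite !Cmod_mult, !Cmod_pow.
  generalize (HB2 k) (HB2 (n - k)%nat) (Cmod_ge_0 (/ qpoch (q ^ 2) (q ^ 2) k))
    (Cmod_ge_0 (/ qpoch (q ^ 2) (q ^ 2) (n - k)))
    (pow_le _ k (Cmod_ge_0 a)) (pow_le _ (n - k) (Cmod_ge_0 b)).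
  intros h1 h2 h3 h4 h5 h6.
  replace (Cmod a ^ k * Cmod (/ qpoch (q ^ 2) (q ^ 2) k) *
    (Cmod b ^ (n - k) * Cmod (/ qpoch (q ^ 2) (q ^ 2) (n - k))))%R
    with (Cmod a ^ k * Cmod b ^ (n - k) *
     (Cmod (/ qpoch (q ^ 2) (q ^ 2) k)
      * Cmod (/ qpoch (q ^ 2) (q ^ 2) (n - k))))%R by ring.
  apply Rmult_le_compat_l; [apply Rmult_le_pos; assumption|].
  apply Rmult_le_compat; assumption.
- apply (ex_series_scal (K := R_AbsRing) (V := R_NormedModule)).
  exists (/ (1 - Cmod a) * / (1 - Cmod b))%R.
  apply is_series_mult_pos; try (intros; apply pow_le, Cmod_ge_0);
    apply is_series_geom; rewrite Rabs_pos_eq by apply Cmod_ge_0; assumption.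
Qed.

(** In base q^2 the recurrence has the factor 1 - q^(2n+2) = (1 - q^(n+1))(1 + q^(n+1)), whose first
    half cancels against (q;q)_(n+1). Writing F(t) for the series, it becomes F(t) - F(tq) = (a+b) t
    F(t) - ab t^2 (F(t) + q F(tq)). *)
Lemma rogers_szego_functional_equation (a b q t A B : C) :
  (Cmod q < 1)%R ->
  is_series (fun n => rogers_szego n a b (q ^ 2) / qpoch q q n * t ^ n) A ->
  is_series (fun n => rogers_szego n a b (q ^ 2) / qpoch q q n * (t * q) ^ n) B ->
  (1 - a * t) * (1 - b * t) * A = (1 - a * b * q * t ^ 2) * B.
Proof.
intros Hq HA HB.
assert (Hp : (Cmod (q ^ 2) < 1)%R)
  by (rewrite Cmod_pow; generalize (Cmod_ge_0 q); simpl; nra).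
set (g := fun n => rogers_szego n a b (q ^ 2) / qpoch q q n) in *.
assert (Hg0 : g 0%nat = 1)
  by (unfold g; rewrite rogers_szego_0; simpl; field).
assert (Hq1 : 1 - q <> 0) by apply one_minus_neq0, neq1_of_Cmod_lt, Hq.
assert (Hg1 : g 1%nat * (1 - q) = a + b).
{ unfold g; rewrite rogers_szego_1 by exact Hp; simpl; field.
  intros H; apply Hq1; rewrite <- H; ring. }
assert (Hrec : forall n, g (S (S n)) * (1 - q ^ S (S n))
  = (a + b) * g (S n) - a * b * (1 + q ^ S n) * g n).
{ intros n; unfold g; rewrite rogers_szego_rec by exact Hp.
  assert (H0 := qpoch_self_neq0 q n Hq).
  assert (H1 := qpoch_self_neq0 q (S n) Hq).
  assert (H2 := qpoch_self_neq0 q (S (S n)) Hq).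
  change (qpoch q q (S (S n))) with (qpoch q q (S n) * (1 - q * q ^ S n)) in *.
  change (qpoch q q (S n)) with (qpoch q q n * (1 - q * q ^ n)) in *.
  replace ((q ^ 2) ^ S n) with (q ^ S n * q ^ S n)
    by (rewrite <- Cpow_mult_l; f_equal; ring).
  rewrite !(Cpow_S q (S n)), !(Cpow_S q n) in *.
  assert (H3 : 1 - q * q ^ n <> 0) by (intros H3; apply H1; rewrite H3; ring).
  assert (H4 : 1 - q * (q * q ^ n) <> 0)
    by (intros H4; apply H2; rewrite H4; ring).
  field; repeat split; assumption. }
change (is_series (fun n => g n * t ^ n) A) in HA.
change (is_series (fun n => g n * (t * q) ^ n) B) in HB.
clearbody g.
(* The recurrence governs only coefficients of index at least 2, so initial terms are removed before
   comparing. *)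
assert (HA1 := is_series_C_tail _ _ HA).
assert (HA2 := is_series_C_tail _ _ HA1).
assert (HB2 := is_series_C_tail _ _ (is_series_C_tail _ _ HB)).
assert (HL := is_series_C_plus _ _ _ _ HA2
  (is_series_C_plus _ _ _ _ (is_series_C_scal (- (a + b) * t) _ _ HA1)
     (is_series_C_scal (a * b * t ^ 2) _ _ HA))).
assert (HR := is_series_C_plus _ _ _ _ HB2
  (is_series_C_scal (- a * b * q * t ^ 2) _ _ HB)).
cbv beta in HL, HR.
assert (Heq : A - g 0%nat * t ^ 0 - g 1%nat * t ^ 1
    + (- (a + b) * t * (A - g 0%nat * t ^ 0) + a * b * t ^ 2 * A)
  = B - g 0%nat * (t * q) ^ 0 - g 1%nat * (t * q) ^ 1
    + - a * b * q * t ^ 2 * B).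
{ apply (is_series_C_unique _ _ _ HL).
  eapply is_series_C_ext; [|reflexivity|exact HR].
  intros n; cbv beta; rewrite !Cpow_mult_l.
  replace (g (S (S n)) * (t ^ S (S n) * q ^ S (S n)))
    with (g (S (S n)) * t ^ S (S n)
          - t ^ S (S n) * (g (S (S n)) * (1 - q ^ S (S n)))) by ring.
  rewrite Hrec, !Cpow_S; simpl; ring. }
rewrite Hg0 in Heq.
(* The removed terms are added back; they balance because [g 0] is 1 and [g 1 * (1 - q)] is
   [a + b]. *)
transitivity ((A - 1 * t ^ 0 - g 1%nat * t ^ 1
    + (- (a + b) * t * (A - 1 * t ^ 0) + a * b * t ^ 2 * A))
    + (1 + g 1%nat * t - (a + b) * t)); [simpl; ring|].
rewrite Heq, <- Hg1; simpl; ring.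
Qed.

Lemma rogers_szego_series (a b q : C) :
  (Cmod q < 1)%R -> (Cmod a < 1)%R -> (Cmod b < 1)%R ->
  is_series (fun n => rogers_szego n a b (q ^ 2) / qpoch q q n)
    (qpoch_inf (a * b * q) (q ^ 2) / (qpoch_inf a q * qpoch_inf b q)).
Proof.
intros Hq Ha Hb.
assert (Hp : (Cmod (q ^ 2) < 1)%R)
  by (rewrite Cmod_pow; generalize (Cmod_ge_0 q); simpl; nra).
set (g := fun n => rogers_szego n a b (q ^ 2) / qpoch q q n).
assert (Hg : abs_summable g) by (apply rogers_szego_abs_summable; assumption).
set (G := fun M => C_Series (fun n => g n * (q ^ M) ^ n)).
assert (HG : forall M, is_series (fun n => g n * (q ^ M) ^ n) (G M)).
{ intros M; apply C_Series_correct.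
  apply (abs_summable_mult_bounded _ _ 1); [|exact Hg].
  intros n; apply Cmod_pow_le_1, Cmod_pow_le_1; lra. }
(* [G M] is the generating function at [a * q ^ M], [b * q ^ M]. The cross-multiplied form postpones
   division to the limit; the base is q^2 on the right because the functional equation contains the
   square of [q ^ M]. *)
assert (Hiter : forall M, qpoch a q M * qpoch b q M * G 0%nat
  = qpoch (a * b * q) (q ^ 2) M * G M).
{ induction M as [|M IH]; [simpl; ring|].
  assert (HGS := HG (S M)).
  replace (q ^ S M) with (q ^ M * q) in HGS by (rewrite Cpow_S; ring).
  assert (Hfun := rogers_szego_functional_equation a b q (q ^ M) _ _ Hq
    (HG M) HGS).
  rewrite !qpoch_succ.
  transitivity (qpoch a q M * qpoch b q M * G 0%nat
    * ((1 - a * q ^ M) * (1 - b * q ^ M))); [ring|].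
  rewrite IH.
  transitivity (qpoch (a * b * q) (q ^ 2) M
    * ((1 - a * q ^ M) * (1 - b * q ^ M) * G M)); [ring|].
  replace ((q ^ 2) ^ M) with ((q ^ M) ^ 2)
    by (rewrite <- !Cpow_mult_r; f_equal; lia).
  rewrite Hfun; ring. }
assert (Hlim := C_lim_mult _ _ _ _ (qpoch_cv (a * b * q) (q ^ 2) Hp)
  (series_at_geometric_cv g G q Hq Hg HG)).
assert (Hlim' := C_lim_mult _ _ _ _
  (C_lim_mult _ _ _ _ (qpoch_cv a q Hq) (qpoch_cv b q Hq))
  (filterlim_const (G 0%nat) : filterlim _ eventually _)).
assert (H0 : qpoch_inf a q * qpoch_inf b q * G 0%nat
  = qpoch_inf (a * b * q) (q ^ 2) * g 0%nat).
{ apply (C_lim_unique _ _ _ Hlim').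
  eapply filterlim_ext; [|exact Hlim].
  intros M; symmetry; apply Hiter. }
replace (g 0%nat) with (RtoC 1) in H0
  by (unfold g; rewrite rogers_szego_0; simpl; field).
eapply is_series_C_ext; [| |apply (HG 0%nat)].
- intros n; simpl; rewrite Cpow_1_l; ring.
- rewrite Cmult_1_r in H0; rewrite <- H0; field.
  split; apply qpoch_inf_neq0_small; assumption.
Qed.

(** * The expansion *)

(** Factorwise (1 - z)(1 + z) = 1 - z^2; at [x = sa * sb] this relates the denominators on the left
    to (ab;q^2)_n. *)
Lemma qpoch_mult_opp (x q : C) (n : nat) :
  qpoch (x * x) (q ^ 2) n = qpoch x q n * qpoch (- x) q n.
Proof.
induction n as [|n IH]; [simpl; ring|].
rewrite !qpoch_succ, IH.
replace ((q ^ 2) ^ n) with ((q ^ n) ^ 2)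
  by (rewrite <- !Cpow_mult_r; f_equal; lia).
ring.
Qed.

Theorem theorem1p4 (q a b c sa sb : C)
  (hq0 : (0 < Cmod q)%R) (hq1 : (Cmod q < 1)%R)
  (ha : (Cmod a < 1)%R) (hb : (Cmod b < 1)%R)
  (hc : forall j : nat, c <> - / q ^ (j + 1))
  (hsa : sa ^ 2 = a) (hsb : sb ^ 2 = b) (hsab : sa + sb <> 0) :
  exists s : C,
    is_series (fun n : nat =>
      sa / (sa + sb)
        * (rogers_szego n a (b * q) (q ^ 2) / (qpoch q q n * qpoch (- c * q) q n))
      + sb / (sa + sb)
        * (rogers_szego n (a * q) b (q ^ 2) / (qpoch q q n * qpoch (- c * q) q n)))
      s
    /\
    is_series (fun n : nat =>
      (qpoch a q n * qpoch b q n)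
        / (qpoch q q n * qpoch (sa * sb) q n * qpoch (- (sa * sb)) q (n + 1))
        * q ^ (n * (n + 1) / 2) * c ^ n)
      (qpoch_inf a q * qpoch_inf b q * qpoch_inf (- c * q) q
         / qpoch_inf (a * b) (q ^ 2) * s).
Proof.
assert (hqn0 : q <> 0) by (intros H; rewrite H, Cmod_0 in hq0; lra).
assert (hp : (Cmod (q ^ 2) < 1)%R)
  by (rewrite Cmod_pow; generalize (Cmod_ge_0 q); simpl; nra).
(* The excluded values of [c] are exactly the zeros of the factors of (-cq;q)_n. *)
assert (hcq : forall j, - c * q * q ^ j <> 1).
{ intros j H; apply (hc j).
  assert (Hqj : q ^ (j + 1) <> 0) by apply Cpow_nz, hqn0.
  replace c with (- (- c * q * q ^ j) / q ^ (j + 1)).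
  - rewrite H; field; exact Hqj.
  - rewrite Cpow_add_r, Cpow_1_r in *; field.
    split; [exact hqn0|apply Cpow_nz, hqn0]. }
assert (hsalt : (Cmod sa < 1)%R).
{ rewrite <- hsa, Cmod_pow in ha; generalize (Cmod_ge_0 sa); simpl in ha; nra. }
assert (hsblt : (Cmod sb < 1)%R).
{ rewrite <- hsb, Cmod_pow in hb; generalize (Cmod_ge_0 sb); simpl in hb; nra. }
assert (hss : (Cmod (sa * sb) < 1)%R).
{ rewrite Cmod_mult; generalize (Cmod_ge_0 sa) (Cmod_ge_0 sb); nra. }
assert (hab : (Cmod (a * b) < 1)%R).
{ rewrite Cmod_mult; generalize (Cmod_ge_0 a) (Cmod_ge_0 b); nra. }
assert (haq : (Cmod (a * q) < 1)%R).
{ rewrite <- (Cpow_1_r q); apply Cmod_mult_pow_lt; lra. }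
assert (hbq : (Cmod (b * q) < 1)%R).
{ rewrite <- (Cpow_1_r q); apply Cmod_mult_pow_lt; lra. }
(* The double series has terms [u m * g n * (q ^ m) ^ n]. By homogeneity of h_n, summing over [n]
   evaluates the generating functions at arguments scaled by [q ^ m]; summing over [m] is Euler's
   series at [c * q ^ n]. *)
set (u := fun m => q ^ (m * (m + 1) / 2) * c ^ m / qpoch q q m).
set (g := fun n =>
  sa / (sa + sb) * (rogers_szego n a (b * q) (q ^ 2) / qpoch q q n)
  + sb / (sa + sb) * (rogers_szego n (a * q) b (q ^ 2) / qpoch q q n)).
set (G := fun x y =>
  qpoch_inf (x * y * q) (q ^ 2) / (qpoch_inf x q * qpoch_inf y q)).
set (Phi := fun m =>
  sa / (sa + sb) * G (a * q ^ m) (b * q * q ^ m)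
  + sb / (sa + sb) * G (a * q * q ^ m) (b * q ^ m)).
destruct (is_series_C_exchange u g Phi
  (fun n => qpoch_inf (- (c * q ^ n) * q) q) (fun m n => (q ^ m) ^ n))
  as [sigma [HS1 HS2]].
- apply euler_abs_summable; assumption.
- assert (H1 := rogers_szego_abs_summable a (b * q) q hq1 ha hbq).
  assert (H2 := rogers_szego_abs_summable (a * q) b q hq1 haq hb).
  eapply abs_summable_le;
    [|apply (ex_series_plus (K := R_AbsRing) (V := R_NormedModule) _ _
       (ex_series_scal (K := R_AbsRing) (V := R_NormedModule)
          (Cmod (sa / (sa + sb))) _ H1)
       (ex_series_scal (K := R_AbsRing) (V := R_NormedModule)
          (Cmod (sb / (sa + sb))) _ H2))].
  intros n; eapply Rle_trans; [apply Cmod_triangle|].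
  rewrite (Cmod_mult (sa / _)), (Cmod_mult (sb / _)); apply Rle_refl.
- intros m n; apply Cmod_pow_le_1, Cmod_pow_le_1; lra.
- intros m.
  assert (hm : (Cmod q <= 1)%R) by lra.
  assert (H1 := rogers_szego_series (a * q ^ m) (b * q * q ^ m) q hq1
    (Cmod_mult_pow_lt _ _ m ha hm) (Cmod_mult_pow_lt _ _ m hbq hm)).
  assert (H2 := rogers_szego_series (a * q * q ^ m) (b * q ^ m) q hq1
    (Cmod_mult_pow_lt _ _ m haq hm) (Cmod_mult_pow_lt _ _ m hb hm)).
  eapply is_series_C_ext; [|reflexivity|
    exact (is_series_C_plus _ _ _ _
      (is_series_C_scal (sa / (sa + sb)) _ _ H1)
      (is_series_C_scal (sb / (sa + sb)) _ _ H2))].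
  intros n; unfold g; cbv beta; rewrite !rogers_szego_scale.
  unfold Cdiv; ring.
- intros n.
  eapply is_series_C_ext; [|reflexivity|
    apply (euler_series (c * q ^ n) q hq0 hq1)].
  intros m; unfold u; rewrite Cpow_mult_l, <- !Cpow_mult_r, (Nat.mul_comm n m).
  unfold Cdiv; ring.
- assert (HC0 : qpoch_inf (- c * q) q <> 0)
    by (apply qpoch_inf_neq0; assumption).
  (* Euler's series gives (-cq^(n+1);q)_oo = (-cq;q)_oo / (-cq;q)_n, so [sigma] exceeds the wanted
     sum by the factor (-cq;q)_oo. *)
  exists (sigma / qpoch_inf (- c * q) q); split.
  + eapply is_series_C_ext; [| |
      apply (is_series_C_scal (/ qpoch_inf (- c * q) q) _ _ HS2)].
    2: unfold Cdiv; ring.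
    intros n; unfold g; cbv beta.
    assert (Hn := qpoch_neq0 (- c * q) q n hcq).
    assert (Hqn := qpoch_self_neq0 q n hq1).
    rewrite (qpoch_inf_split (- c * q) q n hq1) in *.
    replace (- (c * q ^ n) * q) with (- c * q * q ^ n) by ring.
    assert (HCn : qpoch_inf (- c * q * q ^ n) q <> 0)
      by (intros H; apply HC0; rewrite H; ring).
    field; repeat split; assumption.
  + assert (HAB : qpoch_inf (a * b) (q ^ 2) <> 0)
      by (apply qpoch_inf_neq0_small; assumption).
    eapply is_series_C_ext; [| |
      apply (is_series_C_scal
        (qpoch_inf a q * qpoch_inf b q / qpoch_inf (a * b) (q ^ 2)) _ _ HS1)].
    2: field; split; assumption.
    intros m; unfold u, Phi, G; cbv beta.
    assert (hm : (Cmod q <= 1)%R) by lra.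
    assert (ham := qpoch_inf_neq0_small _ q (Cmod_mult_pow_lt _ _ m ha hm) hq1).
    assert (hbm := qpoch_inf_neq0_small _ q (Cmod_mult_pow_lt _ _ m hb hm) hq1).
    (* Peeling one factor brings both values of [G] over the common products [A] and [B], with only
       1 - at or 1 - bt left over, where t = q^m. *)
    assert (Hsplit1 : forall x, qpoch_inf (x * q ^ m) q
       = (1 - x * q ^ m) * qpoch_inf (x * q * q ^ m) q).
    { intros x; rewrite (qpoch_inf_split (x * q ^ m) q 1 hq1); simpl.
      rewrite !Cmult_1_r, Cmult_1_l; f_equal; f_equal; ring. }
    assert (hT : (q ^ 2) ^ S m = (q ^ m) ^ 2 * q ^ 2)
      by (rewrite <- !Cpow_mult_r, <- Cpow_add_r; f_equal; lia).
    assert (hT0 : (q ^ 2) ^ m = (q ^ m) ^ 2)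
      by (rewrite <- !Cpow_mult_r; f_equal; lia).
    (* Both numerators are the same tail of (ab;q^2)_oo, after [S m] factors. *)
    replace (a * q ^ m * (b * q * q ^ m) * q)
      with (a * b * (q ^ 2) ^ S m) by (rewrite hT; ring).
    replace (a * q * q ^ m * (b * q ^ m) * q)
      with (a * b * (q ^ 2) ^ S m) by (rewrite hT; ring).
    rewrite (qpoch_inf_split (a * b) (q ^ 2) (S m) hp) in *.
    rewrite (qpoch_inf_split a q m hq1), (qpoch_inf_split b q m hq1).
    rewrite Nat.add_1_r, !qpoch_succ, hT0 in *.
    rewrite (Hsplit1 a), (Hsplit1 b) in *.
    replace (qpoch (a * b) (q ^ 2) m)
      with (qpoch (sa * sb) q m * qpoch (- (sa * sb)) q m) in *
      by (rewrite <- qpoch_mult_opp; f_equal; rewrite <- hsa, <- hsb; ring).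
    assert (Hqm := qpoch_self_neq0 q m hq1).
    set (A := qpoch_inf (a * q * q ^ m) q) in *.
    set (B := qpoch_inf (b * q * q ^ m) q) in *.
    set (T := qpoch_inf (a * b * (q ^ 2) ^ S m) (q ^ 2)) in *.
    set (t := q ^ m) in *.
    set (P1 := qpoch (sa * sb) q m) in *.
    set (P2 := qpoch (- (sa * sb)) q m) in *.
    clearbody A B T P1 P2.
    rewrite <- hsa in ham, HAB |- *.
    rewrite <- hsb in hbm, HAB |- *.
    assert (Hnz : forall x y, x * y <> 0 -> x <> 0 /\ y <> 0).
    { intros x y H; split; intros H'; apply H; rewrite H'; ring. }
    destruct (Hnz _ _ ham) as [HA1 HA2].
    destruct (Hnz _ _ hbm) as [HB1 HB2].
    destruct (Hnz _ _ HAB) as [HAB' HT].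
    destruct (Hnz _ _ HAB') as [HP HPt].
    destruct (Hnz _ _ HP) as [HP1 HP2].
    (* The combination of the two values of [G] produces 1 - [sa * sb * t], which cancels one of
       these factors; the other one survives and explains the index [n + 1] on the left. *)
    replace (1 - sa ^ 2 * sb ^ 2 * t ^ 2)
      with ((1 - sa * sb * t) * (1 - - (sa * sb) * t)) in * by ring.
    destruct (Hnz _ _ HPt) as [Ht1 Ht2].
    field; repeat split; assumption.
Qed.
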